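(* Let $G$ be a connected simple graph on $n\ge 3$ vertices, and let $\Phi=\{\phi_i\}_{i\in[n]}$ be an $L_G(n,n-1)$-frame for $\mathbb{C}^{n-1}$ with frame operator $S_\Phi$. If $\Psi=\{\psi_i\}_{i\in[n]}$ is a dual frame of $\Phi$, then $\rho^{(2)}_{\Phi,\Psi}\ge 1$. Further, $\rho^{(2)}_\Phi=1$, and the canonical dual frame $S_\Phi^{-1}\Phi$ is the unique spectrally optimal dual frame of $\Phi$ for $2$-erasures.
   Context: Write $[n]=\{1,\dots,n\}$; inner products on $\mathbb{C}^d$ are standard and linear in the first argument. A finite sequence $\Phi=\{\phi_i\}_{i\in[n]}$ in $\mathbb{C}^d$ is a frame for $\mathbb{C}^d$ if there are constants $0<A\le B$ with $A\|f\|^2\le\sum_{i\in[n]}|\langle f,\phi_i\rangle|^2\le B\|f\|^2$ for all $f\in\mathbb{C}^d$. Its frame operator is $S_\Phi f=\sum_{i\in[n]}\langle f,\phi_i\rangle\phi_i$ (invertible). A frame $\Psi=\{\psi_i\}_{i\in[n]}$ of $\mathbb{C}^d$ is a dual frame of $\Phi$ if $f=\sum_{i\in[n]}\langle f,\phi_i\rangle\psi_i=\sum_{i\in[n]}\langle f,\psi_i\rangle\phi_i$ for all $f\in\mathbb{C}^d$; $D_\Phi$ denotes the set of dual frames of $\Phi$. The canonical dual frame of $\Phi$ is $S_\Phi^{-1}\Phi:=\{S_\Phi^{-1}\phi_i\}_{i\in[n]}\in D_\Phi$. Spectral optimality: for $\Psi\in D_\Phi$ and $\Lambda\subset[n]$,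 the error operator is $E_{\Phi,\Psi,\Lambda}(f)=\sum_{i\in\Lambda}\langle f,\phi_i\rangle\psi_i$ on $\mathbb{C}^d$, and for $1\le r<n$, $\rho^{(r)}_{\Phi,\Psi}:=\max\{\rho(E_{\Phi,\Psi,\Lambda}):\Lambda\subset[n],\ |\Lambda|=r\}$, where $\rho(\cdot)$ is the spectral radius. Put $\rho^{(r)}_\Phi:=\min\{\rho^{(r)}_{\Phi,\widetilde\Psi}:\widetilde\Psi\in D_\Phi\}$. $\Psi\in D_\Phi$ is a spectrally optimal dual frame of $\Phi$ for $1$-erasure if $\rho^{(1)}_{\Phi,\Psi}=\rho^{(1)}_\Phi$. $\Psi$ is a spectrally optimal dual frame of $\Phi$ for $2$-erasures if it is a spectrally optimal dual frame for $1$-erasure and $\rho^{(2)}_{\Phi,\Psi}=\rho^{(2)}_\Phi$ (the minimum being over all of $D_\Phi$). Graph frames: for a simple graph $G$ with $n$ vertices $v_1,\dots,v_n$ and $n-k$ connected components, the Laplacian matrix is $L(G)=D(G)-A(G)$ (degree matrix minus adjacency matrix); it has rank $k$. Write $L(G)=M\,\mathrm{diag}(\lambda_1,\dots,\lambda_k,0,\dots,0)\,M^*$ with $M$ unitary and $\lambda_1,\dots,\lambda_k$ the nonzero eigenvalues, let $M_1$ be the submatrix formed by the first $k$ columns of $M$, and let $B=\mathrm{diag}(\sqrt{\lambda_1},\dots,\sqrt{\lambda_k})M_1^*$. Then $\{B e_i\}_{i\in[n]}$, with $\{e_i\}$ the standard basis of $\mathbb{C}^n$, is a frame for $\mathbb{C}^k$;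 any frame arising in this way is called an $L_G(n,k)$-frame. *)

(* Defs.v *)
From HB Require Import structures.
From mathcomp Require Import all_boot all_order all_algebra.
From mathcomp Require Import sesquilinear spectral.
From mathcomp Require Import complex.
From mathcomp Require Import mathcomp_extra boolp classical_sets reals.

Set Implicit Arguments.
Unset Strict Implicit.
Unset Printing Implicit Defensive.

Import Order.TTheory GRing.Theory Num.Theory.
Local Open Scope classical_set_scope.
Local Open Scope ring_scope.
Local Open Scope sesquilinear_scope.
Local Open Scope complex_scope.

Section Frames.
Variables (R : realType) (n d : nat).
Implicit Types (Phi Psi : 'I_n -> 'rV[R[i]]_d) (L : {set 'I_n}) (r : nat).

(* C is R[i], and the vectors of C^d are row vectors. The inner product
   [dotmx u v] is linear in [u] and conjugate-linear in [v]. *)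
Definition is_frame Phi :=
  exists A B : R, [/\ 0 < A, A <= B &
    forall f, A%:C * dotmx f f <= \sum_i `|dotmx f (Phi i)| ^+ 2
              <= B%:C * dotmx f f].

Definition error_op Phi Psi L (f : 'rV[R[i]]_d) : 'rV[R[i]]_d :=
  \sum_(i in L) dotmx f (Phi i) *: Psi i.

Lemma error_op_is_linear Phi Psi L : linear (error_op Phi Psi L).
Proof.
move=> a u v; rewrite /error_op scaler_sumr -big_split /=; apply: eq_bigr => i _.
by rewrite linearPl scalerDl scalerA.
Qed.

HB.instance Definition _ Phi Psi L :=
  GRing.isLinear.Build R[i] 'rV[R[i]]_d 'rV[R[i]]_d _
    (error_op Phi Psi L) (error_op_is_linear Phi Psi L).

Definition frame_op Phi (f : 'rV[R[i]]_d) : 'rV[R[i]]_d :=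
  \sum_i dotmx f (Phi i) *: Phi i.

Lemma frame_op_is_linear Phi : linear (frame_op Phi).
Proof.
move=> a u v; rewrite /frame_op scaler_sumr -big_split /=; apply: eq_bigr => i _.
by rewrite linearPl scalerDl scalerA.
Qed.

HB.instance Definition _ Phi :=
  GRing.isLinear.Build R[i] 'rV[R[i]]_d 'rV[R[i]]_d _
    (frame_op Phi) (frame_op_is_linear Phi).

Definition dual_frame Phi Psi :=
  is_frame Psi /\
  forall f, f = \sum_i dotmx f (Phi i) *: Psi i /\
            f = \sum_i dotmx f (Psi i) *: Phi i.

(* [inv_lfun] is the two-sided inverse when the operator is invertible, as it is
   when [Phi] is a frame. *)
Definition canonical_dual Phi (i : 'I_n) : 'rV[R[i]]_d :=
  ((linfun (frame_op Phi))^-1)%VF (Phi i).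

(* The eigenvalues form a finite set, nonempty when [d > 0]. *)
Definition spectral_radius (T : 'End('rV[R[i]]_d)) : R :=
  sup [set Normc.normc a | a in [set a | passmx.leigenvalue T a]].

(* The default value 0 of the maximum is harmless: spectral radii are
   nonnegative, and the range is nonempty when [r <= n]. *)
Definition rho r Phi Psi : R :=
  \big[Num.max/0]_(L : {set 'I_n} | #|L| == r)
    spectral_radius (linfun (error_op Phi Psi L)).

(* [is_rho_min r Phi m]: the minimum of [rho r Phi] over the dual frames of
   [Phi] is attained and is equal to [m]. *)
Definition is_rho_min r Phi (m : R) :=
  [set rho r Phi Psi | Psi in dual_frame Phi] m /\
  lbound [set rho r Phi Psi | Psi in dual_frame Phi] m.

Definition spectrally_optimal1 Phi Psi :=
  dual_frame Phi Psi /\ is_rho_min 1 Phi (rho 1 Phi Psi).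

Definition spectrally_optimal2 Phi Psi :=
  spectrally_optimal1 Phi Psi /\ is_rho_min 2 Phi (rho 2 Phi Psi).

End Frames.

Section GraphFrames.
Variables (R : realType) (n : nat).

Definition simple_graph (e : rel 'I_n) := symmetric e /\ irreflexive e.

Definition connected_graph (e : rel 'I_n) := forall x y, connect e x y.

Definition laplacian (e : rel 'I_n) : 'M[R[i]]_n :=
  \matrix_(i, j) (if i == j then #|e i|%:R else 0)
  - \matrix_(i, j) (e i j)%:R.

(* [lam] lists the eigenvalues of the Laplacian, the nonzero ones being the
   first [k]. *)
Definition LG_frame (e : rel 'I_n) (k : nat) (Phi : 'I_n -> 'rV[R[i]]_k) :=
  (n_comp e predT + k = n)%N /\
  exists (le_kn : (k <= n)%N) (M : 'M[R[i]]_n) (lam : 'rV[R]_n),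
    let M1 := colsub (widen_ord le_kn) M in
    let B := diag_mx (\row_(j < k) (Num.sqrt (lam 0 (widen_ord le_kn j)))%:C)
             *m M1^t* in
    [/\ M \is unitarymx,
        forall i : 'I_n, (lam 0 i != 0) = (i < k)%N,
        laplacian e = M *m diag_mx (\row_j (lam 0 j)%:C) *m M^t* &
        forall i, Phi i = (B *m delta_mx i (0 : 'I_1))^T].

End GraphFrames.

(* Main.v *)
Require Import Defs.
From mathcomp Require Import all_boot all_order all_algebra.
From mathcomp Require Import sesquilinear spectral.
From mathcomp Require Import complex.
From mathcomp Require Import boolp classical_sets reals.
From mathcomp Require Import ring lra.
Import Order.TTheory GRing.Theory Num.Theory.
Local Open Scope ring_scope.

(** An [L_G(n,n-1)]-frame [Phi] has synthesis operator with kernel spanned by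
    the all-ones vector [1], because [Phi] factors the Laplacian, whose kernel
    is one-dimensional and contains [1]. Hence the dual frames are exactly the
    translates [S^-1 phi_i + h] of the canonical dual, and the cross-Gram matrix
    is [<psi_i, phi_j> = delta_ij - 1/n + c_j] with [c_j = <h, phi_j>] summing
    to [0]. The error operator of [{i}] has the only possible nonzero eigenvalue
    [1 - 1/n + c_i], so [rho 1] is at least [1 - 1/n] with equality only for
    [c = 0], i.e. [h = 0]. The error operator of [{i, j}] always has the
    eigenvalue [1], with eigenvector [psi_i - psi_j], and its other eigenvalues
    are [0] and [1 + c_i + c_j - 2/n]. *)

Set Implicit Arguments.
Unset Strict Implicit.
Unset Printing Implicit Defensive.

Local Open Scope classical_set_scope.
Local Open Scope sesquilinear_scope.
Local Open Scope complex_scope.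

(** * Eigenvalues and the spectral radius *)

Section SpectralRadius.
Variables (R : realType) (d : nat).
Implicit Type T : 'End('rV[R[i]]_d).

Lemma leigenvalueP T a :
  reflect (exists2 f, f != 0 & T f = a *: f) (passmx.leigenvalue T a).
Proof.
rewrite /passmx.leigenvalue /passmx.leigenspace -subv0.
apply: (iffP idP) => [/subvPn[f] | [f f0 Tf]].
  rewrite memv_ker memv0 !lfunE /= !lfunE /= subr_eq0 => /eqP Tf f0.
  by exists f => //; rewrite Tf !lfunE /= ?lfunE.
apply/subvPn; exists f; last by rewrite memv0.
by rewrite memv_ker !lfunE /= !lfunE /= Tf !lfunE /= ?lfunE subrr.
Qed.

Lemma normc_ge0 (x : R[i]) : 0 <= Normc.normc x.
Proof. by case: x => a b /=; apply: sqrtr_ge0. Qed.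

Lemma spectral_radius_ge0 T : 0 <= spectral_radius T.
Proof.
rewrite /spectral_radius; set E := image _ _.
(* [sup] is [0] on a set without a supremum, so only a nonempty bounded set needs an argument. *)
have [supE|] := pselect (has_sup E); last by move/sup_out->.
have [x Ex] := supE.1; apply: (@le_trans _ _ x); last exact: sup_upper_bound.
by case: Ex => a _ <-; apply: normc_ge0.
Qed.

Lemma spectral_radius_le T M : 0 <= M ->
  (forall a, passmx.leigenvalue T a -> Normc.normc a <= M) ->
  spectral_radius T <= M.
Proof.
move=> M0 leM; rewrite /spectral_radius; set E := image _ _.
have [[x Ex]|E0] := pselect (E !=set0); last first.
  by rewrite sup_out // => -[].
by apply: ge_sup; [exists x | move=> _ [a Ta <-]; apply: leM].
Qed.

(** The bound [M] keeps the set of moduli bounded, so that [sup] does not fall back to its default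
    value [0]. *)
Lemma le_spectral_radius T M a :
  (forall b, passmx.leigenvalue T b -> Normc.normc b <= M) ->
  passmx.leigenvalue T a -> Normc.normc a <= spectral_radius T.
Proof.
move=> leM Ta; apply: ub_le_sup; last by exists a.
by exists M => _ [b Tb <-]; apply: leM.
Qed.

End SpectralRadius.

(** * Linearity of the inner product in its first argument *)

Section DotProduct.
Variables (R : realType) (d : nat).
Implicit Types (u v w : 'rV[R[i]]_d) (a : R[i]).

Lemma dotmxZl a u v : dotmx (a *: u) v = a * dotmx u v.
Proof. exact: linearZl_LR. Qed.

Lemma dotmxDl u v w : dotmx (u + v) w = dotmx u w + dotmx v w.
Proof. exact: linearDl. Qed.

Lemma dotmxBl u v w : dotmx (u - v) w = dotmx u w - dotmx v w.
Proof. exact: linearBl. Qed.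

Lemma dotmx0l v : dotmx 0 v = 0.
Proof. exact: linear0l. Qed.

End DotProduct.

(** Meant for an eigenvector [f] of the error operator of [{i, j}], with [x = <f, phi_i>],
    [y = <f, phi_j>], [t = 1/n], [p = c_i], [q = c_j]. Adding the equations gives
    [(x + y) (1 + p + q - 2t) = a (x + y)]; if [x + y = 0], the first one reduces to [x = a x]. *)
Lemma eigenvalue_of_pair (F : fieldType) (a x y t p q : F) :
    x * (1 - t + p) + y * (0 - t + p) = a * x ->
    x * (0 - t + q) + y * (1 - t + q) = a * y ->
  [\/ x = 0 /\ y = 0, a = 1 | a = 1 + (p + q - t *+ 2)].
Proof.
move=> ax ay; have [xy0|xy0] := eqVneq (x + y) 0; last first.
  by apply: Or33; apply: (mulIf xy0); rewrite mulrDr -ax -ay; ring.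
have yE : y = - x by apply/eqP; rewrite -subr_eq0 opprK addrC xy0.
have [x0|x0] := eqVneq x 0; first by apply: Or31; rewrite yE x0 oppr0.
by apply: Or32; apply: (mulIf x0); rewrite -ax yE; ring.
Qed.

(** * Error operators of one and two erasures *)

Section ErrorOperator.
Variables (R : realType) (n d : nat) (Phi Psi : 'I_n -> 'rV[R[i]]_d).
Local Notation E L := (linfun (error_op Phi Psi L)).

Lemma error_op1 i f : error_op Phi Psi [set i]%SET f = dotmx f (Phi i) *: Psi i.
Proof. by rewrite /error_op big_set1. Qed.

Lemma error_op2 i j f : i != j ->
  error_op Phi Psi [set i; j]%SET f =
    dotmx f (Phi i) *: Psi i + dotmx f (Phi j) *: Psi j.
Proof. by move=> ij; rewrite /error_op big_setU1 ?inE //= big_set1. Qed.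

(** Pair the eigenvector equation with [Phi i] and cancel [<f, phi_i>]; if that pairing is zero, the
    operator kills [f]. *)
Lemma eigenvalue_error1 i a : passmx.leigenvalue (E [set i]%SET) a ->
  a = 0 \/ a = dotmx (Psi i) (Phi i).
Proof.
case/leigenvalueP=> f f0; rewrite lfunE /= error_op1 => Ef.
have [x0|x0] := eqVneq (dotmx f (Phi i)) 0.
  left; move: Ef; rewrite x0 scale0r => /esym/eqP.
  by rewrite scaler_eq0 (negPf f0) orbF => /eqP.
right; apply: (mulIf x0); have := congr1 (fun g => dotmx g (Phi i)) Ef.
by rewrite dotmxZl dotmxZl => <-; apply: mulrC.
Qed.

Lemma rho1_le M : 0 <= M ->
  (forall i, Normc.normc (dotmx (Psi i) (Phi i)) <= M) -> rho 1 Phi Psi <= M.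
Proof.
move=> M0 leM; apply: bigmax_le => // L /cards1P[i ->].
apply: spectral_radius_le => // a /eigenvalue_error1[->|-> //].
by rewrite Normc.normc0.
Qed.

(** [Psi i], when nonzero, is itself an eigenvector with this eigenvalue. *)
Lemma le_rho1 i : Normc.normc (dotmx (Psi i) (Phi i)) <= rho 1 Phi Psi.
Proof.
have Li : #|[set i]%SET| == 1 by rewrite cards1.
apply: le_trans (le_bigmax_cond _ _ Li).
have [psi0|psi0] := eqVneq (Psi i) 0.
  by rewrite psi0 dotmx0l Normc.normc0 spectral_radius_ge0.
apply: (@le_spectral_radius _ _ _ (Normc.normc (dotmx (Psi i) (Phi i)))).
  by move=> b /eigenvalue_error1[->|-> //]; rewrite Normc.normc0 normc_ge0.
by apply/leigenvalueP; exists (Psi i) => //; rewrite lfunE /= error_op1.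
Qed.

Variable c : 'I_n -> R[i].
Hypothesis gramE :
  forall i j, dotmx (Psi i) (Phi j) = (i == j)%:R - n%:R^-1 + c j.

(** Pairing the eigenvector equation with [Phi i] and [Phi j] yields the system of
    [eigenvalue_of_pair]; when both pairings vanish, the operator kills [f] and [a = 0]. *)
Lemma eigenvalue_error2 i j a : i != j ->
  passmx.leigenvalue (E [set i; j]%SET) a ->
  [\/ a = 0, a = 1 | a = 1 + (c i + c j - n%:R^-1 *+ 2)].
Proof.
move=> ij; case/leigenvalueP=> f f0; rewrite lfunE /= error_op2 // => Ef.
have Ex k := congr1 (fun g => dotmx g (Phi k)) Ef.
have := Ex i; rewrite dotmxDl 3!dotmxZl !gramE eqxx eq_sym (negPf ij) => xi.
have := Ex j; rewrite dotmxDl 3!dotmxZl !gramE eqxx (negPf ij) => xj.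
have [[x0 y0]||->] := eigenvalue_of_pair xi xj; [|by constructor..].
apply: Or31; move: Ef; rewrite x0 y0 !scale0r addr0 => /esym/eqP.
by rewrite scaler_eq0 (negPf f0) orbF => /eqP.
Qed.

Lemma rho2_ge1 : (1 < n)%N -> 1 <= rho 2 Phi Psi.
Proof.
move=> n1; have n0 := ltnW n1.
pose i := Ordinal n0; pose j := Ordinal n1; have ij : i != j by [].
have Lij : #|[set i; j]%SET| == 2 by rewrite cards2 ij.
apply: le_trans (le_bigmax_cond _ _ Lij).
rewrite -[X in X <= _](Normc.normc1 R).
(* The last candidate of [eigenvalue_error2], used to bound the moduli of all eigenvalues. *)
pose b := 1 + (c i + c j - n%:R^-1 *+ 2).
apply: (@le_spectral_radius _ _ _ (Num.max 1 (Normc.normc b))).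
  move=> a /(eigenvalue_error2 ij)[]->; rewrite le_max ?Normc.normc0 ?ler01 //.
    by rewrite Normc.normc1 lexx.
  by rewrite lexx orbT.
(* The shift [c k - 1/n] does not depend on the first index and cancels in the difference. At
   [k = i] this also shows that the difference is nonzero. *)
have dE k : dotmx (Psi i - Psi j) (Phi k) = (i == k)%:R - (j == k)%:R.
  by rewrite dotmxBl !gramE opprD addrACA subrr addr0 opprD addrACA subrr addr0.
apply/leigenvalueP; exists (Psi i - Psi j).
  apply: contra_eq_neq (dE i) => ->.
  rewrite dotmx0l eqxx [j == i]eq_sym (negPf ij).
  by rewrite subr0 eq_sym oner_eq0.
rewrite lfunE /= error_op2 // !dE !eqxx [j == i]eq_sym (negPf ij) subr0 sub0r.
by rewrite !scale1r scaleN1r.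
Qed.

Lemma rho2_le1 : (1 < n)%N -> (forall i, c i = 0) -> rho 2 Phi Psi <= 1.
Proof.
move=> n1 c0; apply: bigmax_le => // L /cards2P[i [j [ij ->]]].
apply: spectral_radius_le => // a /(eigenvalue_error2 ij)[]->.
- by rewrite Normc.normc0.
- by rewrite Normc.normc1.
rewrite !c0 addr0 add0r.
(* The remaining eigenvalue [1 - 2/n] is real, so its modulus is an absolute value; [0 <= 1/n <= 1]
   places it in [[-1, 1]]. *)
have -> : 1 - n%:R^-1 *+ 2 = (1 - n%:R^-1 *+ 2)%:C :> R[i].
  by rewrite rmorphB rmorphMn /= fmorphV rmorph_nat.
rewrite /= expr0n addr0 sqrtr_sqr ler_norml.
have nV : n%:R^-1 <= 1 :> R.
  by rewrite invf_le1 ?ltr0n ?ler1n // ltnW.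
have nV0 : 0 <= n%:R^-1 :> R by rewrite invr_ge0.
by rewrite mulr2n; apply/andP; split; lra.
Qed.

End ErrorOperator.

(** * Translates of a complex family with sum zero *)

Lemma normc_sq (R : realType) (x : R[i]) :
  Normc.normc x ^+ 2 = complex.Re x ^+ 2 + complex.Im x ^+ 2.
Proof. by case: x => a b; rewrite sqr_sqrtr // addr_ge0 ?sqr_ge0. Qed.

Section MeanZero.
Variables (R : realType) (n : nat) (c : 'I_n -> R[i]).
Hypothesis sum_c : \sum_i c i = 0.

Lemma sum_Re : \sum_i complex.Re (c i) = 0.
Proof.
have ReD : {morph @complex.Re R : x y / x + y} by move=> [a b] [a' b'].
by rewrite -(big_morph _ ReD (erefl _ : complex.Re 0 = 0)) sum_c.
Qed.

(** The cross terms add up to [2k] times the real part of the sum of [c], which is zero. *)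
Lemma sum_normc_sq_translate (k : R) :
  \sum_i Normc.normc (k%:C + c i) ^+ 2 =
    n%:R * k ^+ 2 + \sum_i Normc.normc (c i) ^+ 2.
Proof.
have E i : Normc.normc (k%:C + c i) ^+ 2 =
    k ^+ 2 + (k *+ 2) * complex.Re (c i) + Normc.normc (c i) ^+ 2.
  by rewrite !normc_sq; case: (c i) => a b /=; rewrite add0r; ring.
rewrite (eq_bigr _ (fun i _ => E i)) big_split big_split /=.
rewrite -[X in _ + X + _]mulr_sumr sum_Re.
by rewrite mulr0 addr0 sumr_const card_ord mulr_natl.
Qed.

(** The mean of the squared moduli is at least [k ^+ 2] and at most [r ^+ 2]. *)
Lemma le_of_normc_translate_le (k r : R) : (0 < n)%N -> 0 <= r ->
  (forall i, Normc.normc (k%:C + c i) <= r) -> k <= r.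
Proof.
move=> n0 r0 ler; have n0R : 0 < n%:R :> R by rewrite ltr0n.
have : n%:R * k ^+ 2 <= n%:R * r ^+ 2.
  apply: (@le_trans _ _ (\sum_i Normc.normc (k%:C + c i) ^+ 2)).
    by rewrite sum_normc_sq_translate lerDl sumr_ge0 // => i _; apply: sqr_ge0.
  have -> : n%:R * r ^+ 2 = \sum_(i < n) r ^+ 2.
    by rewrite sumr_const card_ord mulr_natl.
  by apply: ler_sum => i _; rewrite lerXn2r ?nnegrE ?normc_ge0.
rewrite ler_pM2l // => kr; have [k0|k0] := leP k 0; first exact: le_trans r0.
by rewrite -(@ler_pXn2r _ 2) ?nnegrE // ltW.
Qed.

(** The equality case: the squared moduli sum to at most [n k^2], which leaves nothing for the sum
    of the [|c_i|^2]. *)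
Lemma eq0_of_normc_translate_le (k : R) :
  (forall i, Normc.normc (k%:C + c i) <= k) -> forall i, c i = 0.
Proof.
move=> lek i; apply: Normc.eq0_normc; apply/eqP; rewrite -sqrf_eq0.
have : \sum_i Normc.normc (c i) ^+ 2 <= 0.
  rewrite -(lerD2l (n%:R * k ^+ 2)) -sum_normc_sq_translate addr0.
  have -> : n%:R * k ^+ 2 = \sum_(i < n) k ^+ 2.
    by rewrite sumr_const card_ord mulr_natl.
  apply: ler_sum => j _; rewrite lerXn2r ?nnegrE ?normc_ge0 //.
  (* The hypothesis itself forces [0 <= k], which makes squaring monotone here. *)
  exact: le_trans (normc_ge0 _) (lek j).
move=> s0; have /eqP : \sum_i Normc.normc (c i) ^+ 2 = 0.
  by apply/eqP; rewrite eq_le s0 sumr_ge0 // => j _; apply: sqr_ge0.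
rewrite psumr_eq0 => [/allP/(_ i)/=|j _]; last exact: sqr_ge0.
by rewrite mem_index_enum => /(_ isT).
Qed.

End MeanZero.

(** * Frames as the rows of a matrix *)

Section RowFrames.
Variables (R : realType) (n d : nat).
Implicit Types (A B : 'M[R[i]]_(n, d)) (f : 'rV[R[i]]_d).

Lemma dotmx_row f A i : dotmx f (row i A) = (f *m A^t*) 0 i.
Proof. by rewrite dotmxE !mxE; apply: eq_bigr => k _; rewrite !mxE. Qed.

Lemma dotmx_row_row A B i j : dotmx (row i A) (row j B) = (A *m B^t*) i j.
Proof. by rewrite dotmx_row -row_mul mxE. Qed.

(** Turns frame operators and both reconstruction formulas into right multiplication by a matrix. *)
Lemma sum_dotmx_row f A B :
  \sum_i dotmx f (row i A) *: row i B = f *m (A^t* *m B).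
Proof.
by rewrite mulmxA [RHS]mulmx_sum_row; apply: eq_bigr => i _; rewrite dotmx_row.
Qed.

Lemma dotmx_sum m (f : 'rV[R[i]]_m) : dotmx f f = \sum_j `|f 0 j| ^+ 2.
Proof. by rewrite dotmxE !mxE; apply: eq_bigr => j _; rewrite !mxE normCK. Qed.

Lemma sum_sqr_dotmx_row f A :
  \sum_i `|dotmx f (row i A)| ^+ 2 = dotmx (f *m A^t*) (f *m A^t*).
Proof. by rewrite dotmx_sum; apply: eq_bigr => i _; rewrite dotmx_row. Qed.

Lemma mulmx_id_eq1 (T : 'M[R[i]]_d) : (forall f, f = f *m T) -> T = 1%:M.
Proof.
by move=> fT; apply/row_matrixP=> i; rewrite rowE -fT rowE mulmx1.
Qed.

End RowFrames.

(** * Frames [U D], with [D] positive diagonal and [U] an isometry onto the vectors of sum zero *)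

Section WhitenedFrame.
Variables (R : realType) (n d : nat) (U : 'M[R[i]]_(n, d)) (s : 'rV[R]_d).
Hypothesis UtU : U^t* *m U = 1%:M.
Hypothesis UUt : U *m U^t* = 1%:M - const_mx n%:R^-1.
Hypothesis s_gt0 : forall j, 0 < s 0 j.
Hypothesis n_gt0 : (0 < n)%N.
Hypothesis d_gt0 : (0 < d)%N.

(** [D'] is the inverse of [D]. The frame operator of [Phi] is right multiplication by [D *m D], so
    the rows [Phi'] of [U *m D'] are an explicit form of the canonical dual. *)
Let D := diag_mx (map_mx (real_complex R) s).
Let D' := diag_mx (map_mx (fun x => (x^-1)%:C) s).
Let Phi i := row i (U *m D).
Let Phi' i := row i (U *m D').

Let diag_real (t : 'rV[R[i]]_d) : (forall j, t 0 j \is Num.real) ->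
  (diag_mx t)^t* = diag_mx t.
Proof.
move=> tr; rewrite tr_diag_mx map_diag_mx; congr diag_mx; apply/rowP=> j.
by rewrite !mxE; apply/CrealP.
Qed.

Let Dt : D^t* = D.
Proof. by apply: diag_real => j; rewrite mxE complex_real. Qed.

Let D't : D'^t* = D'.
Proof. by apply: diag_real => j; rewrite mxE complex_real. Qed.

Let DD' : D *m D' = 1%:M.
Proof.
rewrite mulmx_diag -diag_const_mx; congr diag_mx; apply/rowP=> j.
by rewrite !mxE -rmorphM mulfV ?rmorph1 // gt_eqF.
Qed.

Let D'D : D' *m D = 1%:M.
Proof. exact: mulmx1C. Qed.

Let adjM m p q (A : 'M[R[i]]_(m, p)) (B : 'M[R[i]]_(p, q)) :
  (A *m B)^t* = B^t* *m A^t*.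
Proof. by rewrite trmx_mul map_mxM. Qed.

(** With [J] the matrix of entries [1/n], the two hypotheses on [U] give [U^t* = U^t* - U^t* J],
    hence [U^t* J = 0]; and [J] fixes the all-ones vector. *)
Let Ut1 : U^t* *m const_mx 1 = 0 :> 'cV_d.
Proof.
have : U^t* *m (U *m U^t*) *m const_mx 1 = U^t* *m const_mx 1 :> 'cV_d.
  by rewrite mulmxA UtU mul1mx.
rewrite UUt mulmxBr mulmx1 mulmxBl => /eqP.
rewrite subr_eq -subr_eq0 opprD addrA subrr sub0r oppr_eq0 -mulmxA.
have -> : (const_mx n%:R^-1 : 'M[R[i]]_n) *m const_mx 1 = const_mx 1 :> 'cV_n.
  apply/matrixP=> i j; rewrite !mxE (eq_bigr (fun=> n%:R^-1)); last first.
    by move=> k _; rewrite !mxE mulr1.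
  by rewrite sumr_const card_ord -[LHS]mulr_natl mulfV // pnatr_eq0 -lt0n.
by move/eqP.
Qed.

Lemma frame_op_whitened f : frame_op Phi f = f *m (D *m D).
Proof.
rewrite /frame_op sum_dotmx_row; congr mulmx.
by rewrite adjM Dt -mulmxA [U^t* *m _]mulmxA UtU mul1mx.
Qed.

Lemma canonical_dual_whitened : canonical_dual Phi = Phi'.
Proof.
apply/funext => i; rewrite /canonical_dual.
have DDK f : f *m (D *m D) *m (D' *m D') = f.
  by rewrite -mulmxA -[D *m D *m _]mulmxA [D *m (D' *m _)]mulmxA DD' mul1mx DD'
    mulmx1.
have inj : lker (linfun (frame_op Phi)) == 0%VS.
  apply/lker0P=> u v; rewrite !lfunE /= !frame_op_whitened => uv.
  by rewrite -[u]DDK uv DDK.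
(* By injectivity it suffices that the frame operator sends [Phi' i] to [Phi i]. *)
rewrite -[RHS](lker0_lfunK inj) lfunE /= frame_op_whitened; congr (_ _).
by rewrite -!row_mul -mulmxA [D' *m _]mulmxA D'D mul1mx.
Qed.

Lemma canonical_is_frame : is_frame Phi'.
Proof.
pose j0 := Ordinal d_gt0.
have s2 j : 0 < s 0 j ^+ 2 by rewrite exprn_gt0.
have s2' j : 0 < s 0 j ^- 2 by rewrite invr_gt0.
have S0 : 0 < \sum_j s 0 j ^+ 2.
  by rewrite (bigD1 j0) //= ltr_pwDl // sumr_ge0 // => j _; apply: ltW.
have leS j : s 0 j ^+ 2 <= \sum_j s 0 j ^+ 2.
  by rewrite (bigD1 j) //= lerDl sumr_ge0 // => k _; apply: ltW.
have leS' j : s 0 j ^- 2 <= \sum_j s 0 j ^- 2.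
  by rewrite (bigD1 j) //= lerDl sumr_ge0 // => k _; apply: ltW.
have leV j : (\sum_j s 0 j ^+ 2)^-1 <= s 0 j ^- 2 by rewrite lef_pV2 ?posrE.
(* Since [U] is an isometry, the frame sum is that of the [s_j^-2 |f_j|^2]. These two constants
   enclose every [s_j^-2], replacing their minimum and maximum. *)
exists (\sum_j s 0 j ^+ 2)^-1, (\sum_j s 0 j ^- 2); split.
- by rewrite invr_gt0.
- exact: le_trans (leV j0) (leS' j0).
move=> f; rewrite sum_sqr_dotmx_row.
have -> : dotmx (f *m (U *m D')^t*) (f *m (U *m D')^t*)
    = \sum_j (s 0 j ^- 2)%:C * `|f 0 j| ^+ 2.
  have -> : dotmx (f *m (U *m D')^t*) (f *m (U *m D')^t*) =
      dotmx (f *m D') (f *m D').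
    rewrite !dotmxE adjM D't; congr (fun_of_matrix _ 0 0).
    by rewrite !adjM !trmxCK !mulmxA -[_ *m U^t* *m U]mulmxA UtU mulmx1.
  rewrite dotmx_sum; apply: eq_bigr => j _.
  rewrite mul_mx_diag !mxE normrM exprMn mulrC; congr (_ * _).
  by rewrite ger0_norm ?lecR ?invr_ge0 ?ltW // -rmorphXn /= exprVn.
rewrite dotmx_sum !mulr_sumr; apply/andP; split; apply: ler_sum => j _;
  by rewrite ler_wpM2r ?exprn_ge0 // lecR.
Qed.

(** Duality says [D U^t* Q = 1], so [U^t*] kills [Q - U D']. As [U U^t*] is the projection onto sum
    zero, every row of this difference equals its mean row, the witness [h]. *)
Lemma dual_frame_whitened Psi : dual_frame Phi Psi ->
  exists h, forall i, Psi i = Phi' i + h.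
Proof.
case=> _ dual; pose Q := \matrix_i Psi i.
have PsiE i : Psi i = row i Q by rewrite rowK.
have PQ : (U *m D)^t* *m Q = 1%:M.
  apply: mulmx_id_eq1 => f; rewrite -sum_dotmx_row [LHS](dual f).1.
  by apply: eq_bigr => i _; rewrite PsiE.
have UQ : U^t* *m (Q - U *m D') = 0.
  rewrite mulmxBr mulmxA UtU mul1mx; apply/eqP; rewrite subr_eq0; apply/eqP.
  by rewrite -[LHS]mul1mx -D'D -[LHS]mulmxA -Dt [D^t* *m _]mulmxA -adjM PQ mulmx1.
exists (\row_k (\sum_l n%:R^-1 * (Q - U *m D') l k)) => i.
have : U *m U^t* *m (Q - U *m D') = 0 by rewrite -mulmxA UQ mulmx0.
rewrite UUt mulmxBl mul1mx => /eqP; rewrite subr_eq0 => /eqP QE.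
have -> : Psi i = Phi' i + row i (const_mx n%:R^-1 *m (Q - U *m D')).
  by rewrite PsiE /Phi' -linearD /= -QE addrC subrK.
congr (_ + _); apply/rowP=> k; rewrite !mxE.
by apply: eq_bigr => l _; rewrite !mxE.
Qed.

(** [D'] and [D] cancel, so the cross-Gram matrix of [Phi'] and [Phi] is [U *m U^t*]. *)
Lemma gram_whitened h i j :
  dotmx (Phi' i + h) (Phi j) = (i == j)%:R - n%:R^-1 + dotmx h (Phi j).
Proof.
rewrite dotmxDl dotmx_row_row adjM Dt mulmxA -[U *m D' *m D]mulmxA D'D mulmx1.
by rewrite UUt !mxE.
Qed.

Lemma sum_dotmx_whitened h : \sum_j dotmx h (Phi j) = 0.
Proof.
have : (h *m (U *m D)^t* *m const_mx 1 : 'cV_1) 0 0 = 0.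
  by rewrite adjM -!mulmxA Ut1 !mulmx0 mxE.
rewrite mxE => h1; rewrite -[RHS]h1; apply: eq_bigr => j _.
by rewrite dotmx_row [const_mx _ _ _]mxE mulr1.
Qed.

(** Such an [h] is killed by the frame operator, which is invertible. *)
Lemma dotmx_whitened_eq0 h : (forall j, dotmx h (Phi j) = 0) -> h = 0.
Proof.
move=> h0; have : h *m (D *m D) = 0.
  by rewrite -frame_op_whitened /frame_op big1 // => j _; rewrite h0 scale0r.
move/(congr1 (mulmx^~ (D' *m D'))).
rewrite mul0mx -mulmxA -[D *m D *m _]mulmxA [D *m (D' *m _)]mulmxA DD' mul1mx.
by rewrite DD' mulmx1.
Qed.

Lemma canonical_dual_frame : dual_frame Phi Phi'.
Proof.
split; first exact: canonical_is_frame.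
move=> f; rewrite sum_dotmx_row sum_dotmx_row 2!adjM Dt D't.
by split; rewrite -mulmxA [U^t* *m _]mulmxA UtU mul1mx ?DD' ?D'D mulmx1.
Qed.

Lemma optimal_whitened : (1 < n)%N ->
  (forall Psi, dual_frame Phi Psi -> 1 <= rho 2 Phi Psi) /\
  is_rho_min 2 Phi 1 /\
  (forall Psi, spectrally_optimal2 Phi Psi <-> Psi = canonical_dual Phi).
Proof.
move=> n1; have k0 : 0 <= 1 - n%:R^-1 :> R.
  by rewrite subr_ge0 invf_le1 ?ltr0n // ler1n.
have kC : (1 - n%:R^-1)%:C = 1 - n%:R^-1 :> R[i].
  by rewrite rmorphB /= fmorphV rmorph_nat.
have gram0 i j : dotmx (Phi' i) (Phi j) = (i == j)%:R - n%:R^-1 + 0.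
  by rewrite -[Phi' i]addr0 gram_whitened dotmx0l.
have ge1 Psi : dual_frame Phi Psi -> 1 <= rho 2 Phi Psi.
  case/dual_frame_whitened => h PsiE.
  apply: (@rho2_ge1 _ _ _ _ _ (fun j => dotmx h (Phi j))) => // i j.
  by rewrite PsiE gram_whitened.
have min2 : rho 2 Phi Phi' = 1.
  apply/le_anti; rewrite ge1 ?andbT; last exact: canonical_dual_frame.
  exact: (@rho2_le1 _ _ _ _ _ (fun=> 0)).
have ler1 Psi h : (forall i, Psi i = Phi' i + h) -> forall i,
    Normc.normc ((1 - n%:R^-1)%:C + dotmx h (Phi i)) <= rho 1 Phi Psi.
  move=> PsiE i; have := le_rho1 Phi Psi i.
  by rewrite PsiE gram_whitened eqxx kC.
have min1 : rho 1 Phi Phi' <= 1 - n%:R^-1.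
  apply: rho1_le => // i; rewrite gram0 eqxx addr0 -kC /= expr0n addr0.
  by rewrite sqrtr_sqr ger0_norm.
have ge_min1 Psi : dual_frame Phi Psi -> 1 - n%:R^-1 <= rho 1 Phi Psi.
  case/dual_frame_whitened => h PsiE.
  apply: (le_of_normc_translate_le (sum_dotmx_whitened h)) => //; last exact: ler1.
  pose i0 := Ordinal n_gt0.
  exact: le_trans (normc_ge0 _) (le_rho1 Phi Psi i0).
have dual0 := canonical_dual_frame.
have rho_min2 : is_rho_min 2 Phi 1.
  by split; [exists Phi' | move=> _ [Psi dPsi <-]; apply: ge1].
split; first exact: ge1.
split; first exact: rho_min2.
move=> Psi; rewrite canonical_dual_whitened; split=> [opt|->].
  (* Optimality for one erasure, compared with [Phi'], bounds every [|1 - 1/n + c_i|] by [1 - 1/n];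
     the equality case gives [c = 0], hence [h = 0]. *)
  case: opt => -[dPsi [_ lb1]] _; have [h PsiE] := dual_frame_whitened dPsi.
  have h0 : h = 0.
    apply: dotmx_whitened_eq0.
    apply: (eq0_of_normc_translate_le (sum_dotmx_whitened h) (k := 1 - n%:R^-1)).
    move=> i; apply: le_trans (ler1 _ _ PsiE i) _; apply: le_trans min1.
    by apply: lb1; exists Phi'.
  by apply/funext=> i; rewrite PsiE h0 addr0.
split; last by rewrite min2.
split=> //; split; first by exists Phi'.
by move=> _ [Psi' dPsi' <-]; apply: le_trans min1 (ge_min1 _ dPsi').
Qed.

End WhitenedFrame.

(** * The Laplacian and its quadratic form *)

Section Laplacian.
Variables (R : realType) (n : nat) (e : rel 'I_n).
Local Notation L := (laplacian R e).

Lemma degree_sum i : #|e i|%:R = \sum_j (e i j)%:R :> R[i].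
Proof.
rewrite -sum1_card natr_sum big_mkcond /=; apply: eq_bigr => j _.
by rewrite unfold_in; case: (e i j).
Qed.

Lemma laplacian_mul m (v : 'M[R[i]]_(n, m)) i k :
  (L *m v) i k = \sum_j (e i j)%:R * (v i k - v j k).
Proof.
rewrite mulmxBl !mxE (bigD1 i) //= !mxE eqxx big1 ?addr0; last first.
  by move=> j ji; rewrite !mxE eq_sym (negPf ji) mul0r.
rewrite degree_sum mulr_suml -sumrB; apply: eq_bigr => j _.
by rewrite !mxE mulrBr.
Qed.

Lemma laplacian_const : L *m const_mx 1 = 0 :> 'cV_n.
Proof.
apply/matrixP=> i k; rewrite laplacian_mul [RHS]mxE big1 // => j _.
by rewrite !mxE subrr mulr0.
Qed.

(** Exchange [i] and [j] in one of the two copies; by symmetry of [e] the terms at [(i, j)] then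
    combine into [|v_i - v_j|^2]. *)
Lemma laplacian_form (v : 'cV[R[i]]_n) : symmetric e ->
  (v^t* *m (L *m v)) 0 0 *+ 2 =
    \sum_i \sum_j (e i j)%:R * `|v i 0 - v j 0| ^+ 2.
Proof.
move=> esym.
have E : (v^t* *m (L *m v)) 0 0 =
    \sum_i \sum_j (e i j)%:R * ((v i 0)^*%R * (v i 0 - v j 0)).
  rewrite mxE; apply: eq_bigr => i _; rewrite laplacian_mul mulr_sumr.
  by apply: eq_bigr => j _; rewrite !mxE mulrCA.
rewrite mulr2n {1}E exchange_big /= E -big_split /=; apply: eq_bigr => i _.
rewrite -big_split /=; apply: eq_bigr => j _.
rewrite esym normCK -mulrDr; congr (_ * _).
rewrite rmorphB /= [RHS]mulrBr [RHS]addrC -mulNr opprB.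
by congr (_ + _); apply: mulrC.
Qed.

Lemma laplacian_form_ge0 (v : 'cV[R[i]]_n) : symmetric e ->
  0 <= (v^t* *m (L *m v)) 0 0.
Proof.
move=> esym; rewrite -(@pmulrn_lge0 _ _ 2) // laplacian_form //.
apply: sumr_ge0 => i _; apply: sumr_ge0 => j _.
by rewrite mulr_ge0 ?ler0n ?exprn_ge0.
Qed.

End Laplacian.

(** * Laplacians for which only the last eigenvalue vanishes *)

Section LaplacianSpectrum.
Variables (R : realType) (m : nat) (e : rel 'I_m.+1).
Variables (M : 'M[R[i]]_m.+1) (lam : 'rV[R]_m.+1).
Hypothesis esym : symmetric e.
Hypothesis Munit : M \is unitarymx.
Hypothesis lam_neq0 : forall i : 'I_m.+1, (lam 0 i != 0) = (i < m)%N.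
Hypothesis specL : laplacian R e = M *m diag_mx (\row_j (lam 0 j)%:C) *m M^t*.

Let MMt : M *m M^t* = 1%:M.
Proof. exact/unitarymxP. Qed.

Let MtM : M^t* *m M = 1%:M.
Proof. exact: mulmx1C. Qed.

Let MtL : M^t* *m laplacian R e = diag_mx (\row_j (lam 0 j)%:C) *m M^t*.
Proof. by rewrite specL !mulmxA MtM mul1mx. Qed.

(** The eigenvalue is the value of the quadratic form at the unit eigenvector [col j M]. *)
Lemma laplacian_eigenvalue_ge0 j : 0 <= lam 0 j.
Proof.
rewrite -lecR; have := laplacian_form_ge0 (col j M) esym.
have -> : ((col j M)^t* *m (laplacian R e *m col j M)) 0 0 =
    (M^t* *m (laplacian R e *m M)) j j.
  rewrite mxE [RHS]mxE; apply: eq_bigr => k _.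
  congr (_ * _); first by rewrite !mxE.
  by rewrite mxE [RHS]mxE; apply: eq_bigr => l _; rewrite [col _ _ _ _]mxE.
by rewrite mulmxA MtL -mulmxA MtM mulmx1 !mxE eqxx.
Qed.

Lemma laplacian_eigenvalue_gt0 (j : 'I_m.+1) : (j < m)%N -> 0 < lam 0 j.
Proof. by rewrite -lam_neq0 lt_def laplacian_eigenvalue_ge0 andbT. Qed.

(** The all-ones vector lies in the kernel, so it is orthogonal to the columns of nonzero eigenvalue
    and equals [t] times the last column. That column is therefore constant, and it has norm one. *)
Lemma laplacian_null_column i k : M i ord_max * (M k ord_max)^*%R = m.+1%:R^-1.
Proof.
pose t := (M^t* *m const_mx 1 : 'cV_m.+1) ord_max 0.
have Mt (j : 'I_m.+1) : (j < m)%N -> (M^t* *m const_mx 1 : 'cV_m.+1) j 0 = 0.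
  rewrite -lam_neq0 => lamj; have lamC : (lam 0 j)%:C != 0 :> R[i].
    by apply: contra_neq lamj => /complexI.
  apply: (mulfI lamC); rewrite mulr0.
  have := congr1 (fun A : 'M_m.+1 => (A *m const_mx 1 : 'cV_m.+1) j 0) MtL.
  by rewrite -!mulmxA laplacian_const mulmx0 mul_diag_mx !mxE => <-.
have Mlast a : M a ord_max * t = 1.
  have := congr1 (fun A : 'M_m.+1 => (A *m const_mx 1 : 'cV_m.+1) a 0) MMt.
  rewrite mul1mx -mulmxA mxE [RHS]mxE => <-.
  rewrite (bigD1 ord_max) //= big1 ?addr0 // => j jmax.
  rewrite Mt ?mulr0 // ltn_neqAle -ltnS ltn_ord andbT.
  by apply: contra_neq jmax => jm; apply/val_inj.
have t0 : t != 0.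
  by apply: contra_eq_neq (Mlast i) => ->; rewrite mulr0 eq_sym oner_eq0.
have Mt' a : M a ord_max = t^-1 by apply: (mulIf t0); rewrite Mlast mulVf.
have := congr1 (fun A : 'M_m.+1 => A ord_max ord_max) MtM.
rewrite !mxE eqxx (eq_bigr (fun=> t^-1 * (t^-1)^*%R)); last first.
  by move=> a _; rewrite !mxE Mt' mulrC.
rewrite sumr_const card_ord -[LHS]mulr_natl => N.
have n0 : m.+1%:R != 0 :> R[i] by rewrite pnatr_eq0.
by rewrite !Mt'; apply: (mulfI n0); rewrite N mulfV.
Qed.

(** The conjugate appears because frame vectors are columns of a multiple of [M1^t*], read as rows.
    The second identity is [M *m M^t* = 1] with the constant contribution of the last column
    removed. *)
Lemma laplacian_isometry (le_m : (m <= m.+1)%N) :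
  let U := map_mx Num.conj (colsub (widen_ord le_m) M) in
  U^t* *m U = 1%:M /\ U *m U^t* = 1%:M - const_mx m.+1%:R^-1.
Proof.
split; apply/matrixP=> i k.
  have := congr1 (fun A : 'M_m.+1 => A (widen_ord le_m k) (widen_ord le_m i)) MtM.
  rewrite !mxE /= -(inj_eq val_inj) /= eq_sym => <-.
  by apply: eq_bigr => l _; rewrite !mxE conjCK mulrC.
have := congr1 (fun A : 'M_m.+1 => A k i) MMt.
rewrite !mxE big_ord_recr /= [k == i]eq_sym => <-.
rewrite mxE [in RHS]mxE laplacian_null_column addrK.
apply: eq_bigr => l _; rewrite !mxE conjCK mulrC.
by rewrite (_ : widen_ord le_m l = widen_ord (leqnSn m) l) //; apply: val_inj.
Qed.

End LaplacianSpectrum.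

Theorem theorem4p2 (R : realType) (n : nat) (hn : (3 <= n)%N)
    (e : rel 'I_n) (he : simple_graph e) (hconn : connected_graph e)
    (Phi : 'I_n -> 'rV[R[i]]_n.-1) (hPhi : LG_frame e Phi) :
  (forall Psi : 'I_n -> 'rV[R[i]]_n.-1, dual_frame Phi Psi -> 1 <= rho 2 Phi Psi) /\
  is_rho_min 2 Phi 1 /\
  (forall Psi : 'I_n -> 'rV[R[i]]_n.-1,
     spectrally_optimal2 Phi Psi <-> Psi = canonical_dual Phi).
Proof.
case: hPhi => _ [le_n [M [lam [Munit lam0 specL PhiE]]]].
(* With [n = m.+1], the dimension [n.-1] computes to [m], and [lam0] says that exactly the last
   eigenvalue is zero. *)
case: n hn e he hconn Phi le_n M lam Munit lam0 specL PhiE => [|m] // hn e he _ Phi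
  le_n M lam Munit lam0 specL PhiE.
pose s : 'rV[R]_m := \row_j Num.sqrt (lam 0 (widen_ord le_n j)).
have [UtU UUt] := laplacian_isometry Munit lam0 specL le_n.
have s_gt0 j : 0 < s 0 j.
  by rewrite mxE sqrtr_gt0 (laplacian_eigenvalue_gt0 he.1 Munit lam0 specL) /=.
(* Entry [j] of [B e_i] is [sqrt lam_j] times the conjugate of [M i j], which is the form [U D]
   treated above. *)
have -> : Phi = fun i => row i (map_mx Num.conj (colsub (widen_ord le_n) M)
    *m diag_mx (map_mx (real_complex R) s)).
  apply/funext=> i; rewrite PhiE; apply/rowP=> j.
  by rewrite -colE mul_diag_mx mul_mx_diag !mxE mulrC.
by apply: optimal_whitened => //; rewrite -ltnS // ltnW.
Qed.
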